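(* For $n\ge0$ let $A_n=\frac{1}{(2n)!}\sum_{\lambda\vdash n}|\phi(\lambda)|\,p_\lambda$ (so $A_0=1$). Then $(A_0,A_1,A_2,\dots)$ is a sprout sequence with seed $\sec(\sqrt t)$, i.e. $\sum_{n\ge0}A_nt^n=\prod_{i\ge1}\sec(\sqrt{x_it})$, where $\sec(\sqrt t)$ denotes the power series $\sum_{n\ge0}E_{2n}\frac{t^n}{(2n)!}$.
   Context: For $\lambda=\langle 1^{m_1},\dots,n^{m_n}\rangle\vdash n$ ($m_k$ parts equal to $k$), $\phi(\lambda)=(2n)!\prod_{k=1}^n\frac{1}{m_k!}\left(\frac{4^k(4^k-1)B_{2k}}{(2k)(2k)!}\right)^{m_k}$, with $B_{2k}$ Bernoulli numbers. $p_\lambda=p_{\lambda_1}p_{\lambda_2}\cdots$ are power-sum symmetric functions in $\boldsymbol{x}=(x_1,x_2,\dots)$. Euler numbers $E_k$ are defined by $\sec t+\tan t=\sum_{k\ge0}E_k\frac{t^k}{k!}$. *)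

(* Defs.v *)
From HB Require Import structures.
From mathcomp Require Import all_boot all_order all_algebra.
From mathcomp Require Import finmap.
From mathcomp.multinomials Require Import monalg.
From mathcomp Require Import boolp.

Set Implicit Arguments.
Unset Strict Implicit.
Unset Printing Implicit Defensive.

Import Order.TTheory GRing.Theory Num.Theory.
Local Open Scope ring_scope.

Section Convolution.
Variables (R : comNzRingType) (K : eqType) (op : K -> K -> K).
Variable dec : K -> seq (K * K).
Hypothesis dec_uniq : forall m, uniq (dec m).
Hypothesis mem_dec : forall m p, (p \in dec m) = (op p.1 p.2 == m).
Hypothesis opA : associative op.
Hypothesis opC : commutative op.

Let conv (F G : K -> R) m := \sum_(p <- dec m) F p.1 * G p.2.

Lemma convC F G m : conv F G m = conv G F m.
Proof.
rewrite /conv.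
have pe : perm_eq (dec m) [seq (p.2, p.1) | p <- dec m].
  apply: uniq_perm => //.
    by rewrite map_inj_uniq // => -[a b] [c d] /= [-> ->].
  move=> [a b]; apply/idP/mapP => [|[[c d] h [-> ->]]].
    by exists (b, a) => //; move: H; rewrite !mem_dec /= opC.
  by move: h; rewrite !mem_dec /= opC.
rewrite (perm_big _ pe) big_map; apply: eq_bigr => p _ /=.
by rewrite mulrC.
Qed.

Lemma convA F G H m : conv F (conv G H) m = conv (conv F G) H m.
Proof.
rewrite /conv.
under eq_bigr do rewrite mulr_sumr.
under [RHS]eq_bigr do rewrite mulr_suml.
pose s1 := [seq (p.1, (q.1, q.2)) | p <- dec m, q <- dec p.2].
pose s2 := [seq (q.1, (q.2, p.2)) | p <- dec m, q <- dec p.1].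
transitivity (\sum_(t <- s1) F t.1 * (G t.2.1 * H t.2.2)).
  by rewrite big_allpairs_dep.
transitivity (\sum_(t <- s2) F t.1 * (G t.2.1 * H t.2.2)); last first.
  rewrite big_allpairs_dep /=.
  by apply: eq_bigr => p _; apply: eq_bigr => q _; rewrite mulrA.
apply: perm_big; apply: uniq_perm.
- apply: allpairs_uniq_dep => // u v.
  move=> /allpairsPdep [p [q [_ hq ->]]] /allpairsPdep [p' [q' [_ hq' ->]]] /=.
  move: hq hq'; rewrite !mem_dec => /eqP h /eqP h' [e1 e2 e3].
  move: h h'; rewrite e2 e3 => -> h.
  by case: p p' q q' h e1 e2 e3 => [? ?] [? ?] [? ?] [? ?] /= -> -> -> ->.
- apply: allpairs_uniq_dep => // u v.
  move=> /allpairsPdep [p [q [_ hq ->]]] /allpairsPdep [p' [q' [_ hq' ->]]] /=.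
  move: hq hq'; rewrite !mem_dec => /eqP h /eqP h' [e1 e2 e3].
  move: h h'; rewrite e1 e2 => -> h.
  by case: p p' q q' h e1 e2 e3 => [? ?] [? ?] [? ?] [? ?] /= -> -> -> ->.
move=> [a [b c]]; apply/allpairsPdep/allpairsPdep => /=.
  move=> [[p1 p2] [[q1 q2] /= [hp hq [-> -> ->]]]].
  move: hp hq; rewrite !mem_dec /= => /eqP hp /eqP hq.
  exists (op p1 q1, q2), (p1, q1); rewrite !mem_dec /=; split=> //.
  by rewrite -opA hq hp.
move=> [[p1 p2] [[q1 q2] /= [hp hq [-> -> ->]]]].
move: hp hq; rewrite !mem_dec /= => /eqP hp /eqP hq.
exists (q1, op q2 p2), (q2, p2); rewrite !mem_dec /=; split=> //.
by rewrite opA hq hp.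
Qed.

End Convolution.

(* R[[t]]; F n is the coefficient of t^n. *)
Definition tps (R : Type) : Type := nat -> R.

HB.instance Definition _ (R : Type) := gen_eqMixin (tps R).
HB.instance Definition _ (R : Type) := gen_choiceMixin (tps R).

Section TpsRing.
Variable R : comNzRingType.
Implicit Types F G H : tps R.

Definition tps_zero : tps R := fun=> 0.
Definition tps_opp F : tps R := fun n => - F n.
Definition tps_add F G : tps R := fun n => F n + G n.
Definition tps_one : tps R := fun n => (n == 0%N)%:R.
Definition tps_mul F G : tps R := fun n => \sum_(i < n.+1) F i * G (n - i)%N.

Fact tps_addA : associative tps_add.
Proof. by move=> F G H; apply/funext => n; rewrite /tps_add addrA. Qed.
Fact tps_addC : commutative tps_add.
Proof. by move=> F G; apply/funext => n; rewrite /tps_add addrC. Qed.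
Fact tps_add0 : left_id tps_zero tps_add.
Proof. by move=> F; apply/funext => n; rewrite /tps_add add0r. Qed.
Fact tps_addN : left_inverse tps_zero tps_opp tps_add.
Proof. by move=> F; apply/funext => n; rewrite /tps_add addNr. Qed.

HB.instance Definition _ :=
  GRing.isZmodule.Build (tps R) tps_addA tps_addC tps_add0 tps_addN.

Let dec n := [seq (i, n - i)%N | i <- iota 0 n.+1].

Fact tps_dec_uniq n : uniq (dec n).
Proof. by rewrite map_inj_uniq ?iota_uniq // => i j []. Qed.

Fact mem_tps_dec n p : (p \in dec n) = ((p.1 + p.2)%N == n).
Proof.
apply/mapP/eqP => [[i]|<-].
  by rewrite mem_iota /= add0n ltnS => le_in -> /=; rewrite subnKC.
exists p.1; first by rewrite mem_iota /= add0n ltnS leq_addr.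
by rewrite addKn; case: p.
Qed.

Fact tps_mulE F G n : tps_mul F G n = \sum_(p <- dec n) F p.1 * G p.2.
Proof.
by rewrite /tps_mul big_map -(big_mkord xpredT (fun i => F i * G (n - i)%N)).
Qed.

Fact tps_mulC : commutative tps_mul.
Proof.
move=> F G; apply/funext => n; rewrite !tps_mulE.
exact: (convC tps_dec_uniq mem_tps_dec addnC).
Qed.

Fact tps_mulA : associative tps_mul.
Proof.
move=> F G H; apply/funext => n; rewrite !tps_mulE.
under eq_bigr do rewrite tps_mulE.
under [RHS]eq_bigr do rewrite tps_mulE.
exact: (convA tps_dec_uniq mem_tps_dec addnA).
Qed.

Fact tps_mul1 : left_id tps_one tps_mul.
Proof.
move=> F; apply/funext => n; rewrite /tps_mul big_ord_recl /= subn0 mul1r.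
by rewrite big1 ?addr0 // => i _; rewrite mul0r.
Qed.

Fact tps_mulDl : left_distributive tps_mul tps_add.
Proof.
move=> F G H; apply/funext => n; rewrite /tps_mul /tps_add -big_split /=.
by apply: eq_bigr => i _; rewrite mulrDl.
Qed.

Fact tps_one_neq0 : tps_one != 0.
Proof.
by apply/eqP => /(congr1 (fun F : tps R => F 0%N)) /eqP; rewrite oner_eq0.
Qed.

HB.instance Definition _ := GRing.Zmodule_isComNzRing.Build (tps R)
  tps_mulA tps_mulC tps_mul1 tps_mulDl tps_one_neq0.

End TpsRing.

Section TpsUnitRing.
Variable R : comUnitRingType.
Implicit Types F G : tps R.

Definition tps_unit : {pred tps R} := [pred F | F 0%N \is a GRing.unit].

(* The first n coefficients of F^-1, each one obtained from the previous ones
   by solving F * F^-1 = 1 in degree k. *)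
Fixpoint tps_inv_seq F n : seq R :=
  if n is k.+1 then
    let s := tps_inv_seq F k in
    rcons s ((F 0%N)^-1 * ((k == 0%N)%:R - \sum_(i < k) s`_i * F (k - i)%N))
  else [::].

Definition tps_inv F : tps R :=
  if F \in tps_unit then fun n => (tps_inv_seq F n.+1)`_n else F.

Fact size_tps_inv_seq F n : size (tps_inv_seq F n) = n.
Proof. by elim: n => //= n IHn; rewrite size_rcons IHn. Qed.

Fact nth_tps_inv_seq F n i : (i < n)%N ->
  (tps_inv_seq F n)`_i = (tps_inv_seq F i.+1)`_i.
Proof.
elim: n => // n IHn; rewrite ltnS leq_eqVlt => /predU1P[-> //|lt_in].
by rewrite [LHS]/= nth_rcons size_tps_inv_seq lt_in IHn.
Qed.

Fact tps_mulV : {in tps_unit, left_inverse 1 tps_inv *%R}.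
Proof.
move=> F uF; apply/funext => n.
rewrite [LHS]/(tps_mul (tps_inv F) F n) /tps_mul /tps_inv uF big_ord_recr /=.
rewrite nth_rcons size_tps_inv_seq ltnn eqxx subnn mulrAC mulVr // mul1r.
under eq_bigr => i _ do
  rewrite -[rcons _ _]/(tps_inv_seq F i.+1) -(nth_tps_inv_seq F (ltn_ord i)).
by rewrite addrC subrK.
Qed.

Fact tps_unitPl F G : G * F = 1 -> tps_unit F.
Proof.
move=> /(congr1 (fun H : tps R => H 0%N)).
rewrite [X in X = _]/(tps_mul G F 0%N) /tps_mul big_ord1 /= subnn => GF1.
by apply/unitrP; exists (G 0%N); split; last rewrite mulrC.
Qed.

Fact tps_inv_out : {in [predC tps_unit], tps_inv =1 id}.
Proof. by move=> F /negbTE; rewrite /tps_inv => ->. Qed.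

HB.instance Definition _ := GRing.ComNzRing_hasMulInverse.Build (tps R)
  tps_mulV tps_unitPl tps_inv_out.

End TpsUnitRing.

Definition cmdivisors (m : {cmonom nat}) : seq {cmonom nat} :=
  [seq d <- [seq mkcmonom [fsfun i : finsupp m => nat_of_ord (f i) | 0%N]
            | f : {ffun finsupp m -> 'I_(mdeg m).+1}]
  | mulcm d (divcm m d) == m].

Lemma mem_cmdivisors (m d : {cmonom nat}) :
  (d \in cmdivisors m) = (mulcm d (divcm m d) == m).
Proof.
rewrite mem_filter; case: eqP => //= dm.
have led i : (d i <= m i)%N by rewrite -dm mulcmE leq_addr.
have lem i : (m i < (mdeg m).+1)%N.
  rewrite ltnS /mdeg; case: (finsuppP m i) => // im.
  by rewrite (big_fsetD1 i) //= leq_addr.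
apply/mapP; exists [ffun i : finsupp m => Ordinal (leq_ltn_trans (led (val i)) (lem (val i)))].
  by rewrite mem_enum.
apply/eqP/cmP => i; rewrite cmE fsfun_ffun.
case: insubP => [j jm <-|im] /=; first by rewrite ffunE.
by apply/eqP; rewrite -leqn0 (leq_trans (led i)) // fsfun_dflt.
Qed.

Lemma cmdivisors_uniq m : uniq (cmdivisors m).
Proof.
apply: filter_uniq; rewrite map_inj_uniq ?enum_uniq // => f g /eqP/cmP e.
apply/ffunP => i; apply/val_inj; move: (e (val i)).
by rewrite !cmE !fsfun_ffun valK.
Qed.

(* R[[x_0, x_1, ...]], formal power series in countably many
   variables; F m is the coefficient of the monomial m. *)
Definition xps (R : Type) : Type := {cmonom nat} -> R.

HB.instance Definition _ (R : Type) := gen_eqMixin (xps R).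
HB.instance Definition _ (R : Type) := gen_choiceMixin (xps R).

Section XpsRing.
Variable R : comNzRingType.
Implicit Types F G H : xps R.

Definition xps_zero : xps R := fun=> 0.
Definition xps_opp F : xps R := fun m => - F m.
Definition xps_add F G : xps R := fun m => F m + G m.
Definition xps_one : xps R := fun m => (m == onecm nat)%:R.
Definition xps_mul F G : xps R :=
  fun m => \sum_(d <- cmdivisors m) F d * G (divcm m d).
Definition xps_scale (a : R) F : xps R := fun m => a * F m.

Fact xps_addA : associative xps_add.
Proof. by move=> F G H; apply/funext => m; rewrite /xps_add addrA. Qed.
Fact xps_addC : commutative xps_add.
Proof. by move=> F G; apply/funext => m; rewrite /xps_add addrC. Qed.
Fact xps_add0 : left_id xps_zero xps_add.
Proof. by move=> F; apply/funext => m; rewrite /xps_add add0r. Qed.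
Fact xps_addN : left_inverse xps_zero xps_opp xps_add.
Proof. by move=> F; apply/funext => m; rewrite /xps_add addNr. Qed.

HB.instance Definition _ :=
  GRing.isZmodule.Build (xps R) xps_addA xps_addC xps_add0 xps_addN.

Let dec m := [seq (d, divcm m d) | d <- cmdivisors m].

Fact xps_dec_uniq m : uniq (dec m).
Proof. by rewrite map_inj_uniq ?cmdivisors_uniq // => d e []. Qed.

Fact mem_xps_dec m p : (p \in dec m) = (mulcm p.1 p.2 == m).
Proof.
apply/mapP/eqP => [[d]|<-].
  by rewrite mem_cmdivisors => /eqP dm ->.
have e : divcm (mulcm p.1 p.2) p.1 = p.2.
  by apply/eqP/cmP => i; rewrite divcmE mulcmE addKn.
by exists p.1; rewrite ?mem_cmdivisors e //; case: p {e}.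
Qed.

Fact xps_mulE F G m : xps_mul F G m = \sum_(p <- dec m) F p.1 * G p.2.
Proof. by rewrite /xps_mul big_map. Qed.

Fact xps_mulC : commutative xps_mul.
Proof.
move=> F G; apply/funext => m; rewrite !xps_mulE.
exact: (convC xps_dec_uniq mem_xps_dec (@mulcmC nat)).
Qed.

Fact xps_mulA : associative xps_mul.
Proof.
move=> F G H; apply/funext => m; rewrite !xps_mulE.
under eq_bigr do rewrite xps_mulE.
under [RHS]eq_bigr do rewrite xps_mulE.
exact: (convA xps_dec_uniq mem_xps_dec (@mulcmA nat)).
Qed.

Fact xps_mul1 : left_id xps_one xps_mul.
Proof.
move=> F; apply/funext => m; rewrite /xps_mul.
have m1 : divcm m (onecm nat) = m.
  by apply/eqP/cmP => i; rewrite divcmE onecmE subn0.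
rewrite (bigD1_seq (onecm nat)) ?cmdivisors_uniq //=; last first.
  by rewrite mem_cmdivisors m1 mul0cm.
rewrite /xps_one eqxx mul1r m1 big1 ?addr0 // => d /negbTE ->.
by rewrite mul0r.
Qed.

Fact xps_mulDl : left_distributive xps_mul xps_add.
Proof.
move=> F G H; apply/funext => m; rewrite /xps_mul /xps_add -big_split /=.
by apply: eq_bigr => d _; rewrite mulrDl.
Qed.

Fact xps_one_neq0 : xps_one != 0.
Proof.
apply/eqP => /(congr1 (fun F : xps R => F (onecm nat))) /eqP.
by rewrite /xps_one eqxx oner_eq0.
Qed.

HB.instance Definition _ := GRing.Zmodule_isComNzRing.Build (xps R)
  xps_mulA xps_mulC xps_mul1 xps_mulDl xps_one_neq0.

Fact xps_scaleA a b F : xps_scale a (xps_scale b F) = xps_scale (a * b) F.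
Proof. by apply/funext => m; rewrite /xps_scale mulrA. Qed.
Fact xps_scale1 : left_id 1 xps_scale.
Proof. by move=> F; apply/funext => m; rewrite /xps_scale mul1r. Qed.
Fact xps_scaleDr : right_distributive xps_scale +%R.
Proof. by move=> a F G; apply/funext => m; exact: mulrDr. Qed.
Fact xps_scaleDl F : {morph xps_scale^~ F : a b / a + b}.
Proof. by move=> a b; apply/funext => m; exact: mulrDl. Qed.

HB.instance Definition _ := GRing.Zmodule_isLmodule.Build R (xps R)
  xps_scaleA xps_scale1 xps_scaleDr xps_scaleDl.

Fact xps_scaleAl (a : R) F G : a *: (F * G) = (a *: F) * G.
Proof.
apply/funext => m.
transitivity (a * \sum_(d <- cmdivisors m) F d * G (divcm m d)); first by [].
by rewrite mulr_sumr; apply: eq_bigr => d _; exact: mulrA.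
Qed.

HB.instance Definition _ := GRing.Lmodule_isLalgebra.Build R (xps R) xps_scaleAl.
HB.instance Definition _ := GRing.Lalgebra_isComAlgebra.Build R (xps R).

End XpsRing.

Definition xvar (R : comNzRingType) (i : nat) : xps R :=
  fun m => (m == ucm i)%:R.

(* The power sum p_k = sum_i x_i^k, for k >= 1 (p_0 does not exist). *)
Definition psum (R : comNzRingType) (k : nat) : xps R :=
  fun m => `[< exists i : nat, m = expcmn (ucm i) k >]%:R.

Definition psum_part (R : comNzRingType) (l : seq nat) : xps R :=
  \prod_(k <- l) psum R k.

Definition is_partition (n : nat) (l : seq nat) : bool :=
  [&& sorted geq l, 0%N \notin l & sumn l == n].

(* The partitions of n, searched for among the sequences of at most n
   integers in {0, ..., n}. *)
Definition partitions (n : nat) : seq (seq nat) :=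
  [seq l <- [seq map val (bseqval s) | s : n.-bseq 'I_n.+1] | is_partition n l].

Lemma mem_partitions n l : (l \in partitions n) = is_partition n l.
Proof.
rewrite mem_filter; case: (boolP (is_partition n l)) => //=.
move=> /and3P[_ l0 /eqP ln].
have szl : (size l <= n)%N.
  rewrite -ln; elim: l l0 {ln} => //= a l IHl; rewrite inE negb_or => /andP[a0 /IHl].
  by case: a a0 => // a _ h; rewrite addSn ltnS (leq_trans h) ?leq_addl.
have ltl : all (fun k => k < n.+1)%N l.
  apply/allP => k; rewrite -ln; elim: l {l0 ln szl} => //= a l IHl.
  rewrite inE ltnS => /predU1P[->|/IHl]; first exact: leq_addr.
  by rewrite ltnS => h; rewrite (leq_trans h) ?leq_addl.
have szs : (size (map (@inord n) l) <= n)%N by rewrite size_map.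
apply/mapP; exists (Bseq szs); first by rewrite mem_enum.
rewrite /= -map_comp -[LHS]map_id; apply/eq_in_map => k kl.
by rewrite /= inordK // (allP ltl).
Qed.

Lemma partitions_uniq n : uniq (partitions n).
Proof.
apply: filter_uniq; rewrite map_inj_uniq ?enum_uniq // => s t.
by move=> /(inj_map val_inj) /val_inj.
Qed.

(* The formal power series of (e^t - 1) / t. *)
Definition expm1_div_t : tps rat := fun n => (n.+1`!%:R)^-1.

(* B_n, from t / (e^t - 1) = sum_n B_n t^n / n! *)
Definition bernoulli (n : nat) : rat := n`!%:R * (expm1_div_t^-1) n.

Definition cos_tps : tps rat :=
  fun n => if odd n then 0 else (-1) ^+ n./2 / n`!%:R.
Definition sin_tps : tps rat :=
  fun n => if odd n then (-1) ^+ n./2 / n`!%:R else 0.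
Definition sec_tps : tps rat := cos_tps^-1.
Definition tan_tps : tps rat := sin_tps / cos_tps.

(* E_k, from sec t + tan t = sum_k E_k t^k / k! *)
Definition euler (k : nat) : rat := k`!%:R * (sec_tps + tan_tps) k.

Definition phi (l : seq nat) : rat :=
  let n := sumn l in
  let m k := count_mem k l in
  (2 * n)`!%:R *
  \prod_(1 <= k < n.+1)
    ((m k)`!%:R^-1 *
     ((4 ^+ k * (4 ^+ k - 1) * bernoulli (2 * k)) /
      ((2 * k)%:R * (2 * k)`!%:R)) ^+ m k).

(* G is the infinite product of the F i: each coefficient of the partial
   products is eventually equal to that of G. *)
Definition is_infprod (R : comNzRingType) (F : nat -> tps (xps R))
    (G : tps (xps R)) : Prop :=
  forall (n : nat) (m : {cmonom nat}),
    exists N0 : nat, forall N : nat, (N0 <= N)%N ->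
      (\prod_(i < N) F i) n m = G n m.

(* f(x_i t) *)
Definition seed_subst (R : comNzRingType) (f : tps R) (i : nat) : tps (xps R) :=
  fun n => f n *: xvar R i ^+ n.

(* The sequence A, as an element of R[[x]][[t]], is sum_n A_n t^n. *)
Definition sprout_sequence (R : comNzRingType) (A : nat -> xps R) (f : tps R)
    : Prop :=
  f 0%N = 1 /\ is_infprod (seed_subst f) A.

(* sec(sqrt t) *)
Definition sec_sqrt : tps rat := fun n => euler (2 * n) / (2 * n)`!%:R.

(* Main.v *)
(** Let [h] be the logarithmic derivative [t f'/f] of [f = sec (sqrt t)]; its
coefficients are [h_k = k c_k] with [2 k c_k] the coefficient of [t^(2k-1)] in
[tan], because [sec' = tan sec].  The identity
[t tanh t = t - 2t/(e^(2t) - 1) + 4t/(e^(4t) - 1)] identifies [c_k], up to sign,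
with the factor of [phi] attached to [k], and [tan' = 1 + tan^2] shows
[c_k >= 0], which accounts for the absolute value.  The finite products
[prod_(i < N) f(x_i t)] and the series [sum_n A_n t^n] are then both solutions
of an equation [t G' = H G] with [H = sum_k h_k p_k t^k], where [p_k] is
truncated to [N] variables in the first case; the second equation amounts to
removing one part from a partition.  Such an equation determines the
coefficients of [G] recursively, and the two recursions agree on monomials in
[x_0, ..., x_(N-1)]. *)

Require Import Defs.
From HB Require Import structures.
From mathcomp Require Import all_boot all_order all_algebra.
From mathcomp Require Import finmap.
From mathcomp.multinomials Require Import monalg.
From mathcomp Require Import boolp ring lra zify.

Set Implicit Arguments.
Unset Strict Implicit.
Unset Printing Implicit Defensive.

Import Order.TTheory GRing.Theory Num.Theory.
Local Open Scope ring_scope.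

(** * One-variable power series: the derivation [t d/dt], dilation and parity *)

Section TpsTheory.
Variable R : comNzRingType.
Implicit Types F G H : tps R.

Lemma tpsD F G n : (F + G) n = F n + G n. Proof. by []. Qed.
Lemma tpsN F n : (- F) n = - F n. Proof. by []. Qed.
Lemma tpsM F G n : (F * G) n = \sum_(i < n.+1) F i * G (n - i)%N.
Proof. by []. Qed.
Lemma tps1 n : (1 : tps R) n = (n == 0%N)%:R. Proof. by []. Qed.

Lemma tpsMn F k n : (F *+ k) n = F n *+ k.
Proof. by elim: k => // k IHk; rewrite !mulrS tpsD IHk. Qed.

Lemma tps_sum I (r : seq I) (P : pred I) (F : I -> tps R) n :
  (\sum_(i <- r | P i) F i) n = \sum_(i <- r | P i) F i n.
Proof. by elim/big_rec2: _ => // i x y _ <-. Qed.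

Definition tps_X : tps R := fun n => (n == 1%N)%:R.

Lemma tps_XM0 F : (tps_X * F) 0%N = 0.
Proof. by rewrite tpsM big_ord1 mul0r. Qed.

Lemma tps_XMS F n : (tps_X * F) n.+1 = F n.
Proof.
rewrite tpsM (bigD1 (lift ord0 ord0)) //= /tps_X /= mul1r subSS subn0.
rewrite big1 ?addr0 // => -[[|[|i]] lt_i] //= _; exact: mul0r.
Qed.

Lemma tps_X_lreg : GRing.lreg tps_X.
Proof. by move=> F G e; apply/funext => n; rewrite -(tps_XMS F) e tps_XMS. Qed.

(** The operator [t d/dt]: a derivation that preserves degrees, so no index is shifted. *)
Definition tps_euler F : tps R := fun n => F n *+ n.

Lemma tps_eulerM F G :
  tps_euler (F * G) = tps_euler F * G + F * tps_euler G.
Proof.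
apply/funext => n; rewrite tpsD !tpsM -big_split /tps_euler tpsM -sumrMnl.
apply: eq_bigr => i _ /=.
by rewrite mulrnAl mulrnAr -mulrnDr subnKC // -ltnS.
Qed.

Lemma tps_euler1 : tps_euler 1 = 0.
Proof. by apply/funext => -[|n]; rewrite /tps_euler ?mulr0n // tps1 mul0rn. Qed.

Lemma tps_euler_prod I (r : seq I) (F H : I -> tps R) :
    (forall i, tps_euler (F i) = H i * F i) ->
  tps_euler (\prod_(i <- r) F i) = (\sum_(i <- r) H i) * \prod_(i <- r) F i.
Proof.
move=> eF; elim: r => [|i r IHr]; first by rewrite !big_nil tps_euler1 mul0r.
by rewrite !big_cons tps_eulerM eF IHr; ring.
Qed.

Definition tps_dilate (a : R) F : tps R := fun n => a ^+ n * F n.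

Lemma tps_dilateM a F G :
  tps_dilate a (F * G) = tps_dilate a F * tps_dilate a G.
Proof.
apply/funext => n; rewrite !tpsM /tps_dilate tpsM mulr_sumr.
apply: eq_bigr => i _; by rewrite mulrACA -exprD subnKC // -ltnS.
Qed.

Lemma tps_dilate1 a : tps_dilate a 1 = 1.
Proof.
by apply/funext => -[|n]; rewrite /tps_dilate !tps1 ?mul1r ?mulr0.
Qed.

Definition tps_even F := forall n, odd n -> F n = 0.

Lemma sum_even (g : nat -> R) n : (forall i, odd i -> g i = 0) ->
  \sum_(i < (2 * n).+1) g i = \sum_(i < n.+1) g (2 * i)%N.
Proof.
move=> g0; elim: n => [|n IHn]; first by rewrite !big_ord1.
rewrite [RHS]big_ord_recr -IHn /= mulnS !big_ord_recr /=.
rewrite [g (2 * n).+1]g0 ?addr0 //.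
by rewrite /= oddM.
Qed.

Definition tps_evenpart F : tps R := fun n => F (2 * n)%N.

(** In even total degree, an even index in [F] forces an even index in [G]. For even [F],
    [tps_evenpart F] is [F(sqrt t)]. *)
Lemma tps_evenpartM F G : tps_even F ->
  tps_evenpart (F * G) = tps_evenpart F * tps_evenpart G.
Proof.
move=> F0; apply/funext => n; rewrite /tps_evenpart !tpsM.
rewrite (sum_even (g := fun i => F i * G (2 * n - i)%N)); last first.
  by move=> i /F0 ->; rewrite mul0r.
by apply: eq_bigr => i _; rewrite mulnBr.
Qed.

(* On even series this is [F(t) |-> F(it)], on odd ones [F(t) |-> -i F(it)];
   it turns circular functions into hyperbolic ones without leaving [R]. *)
Definition tps_twist F : tps R := fun n => (-1) ^+ n./2 * F n.

(** Halving with rounding is additive on [i + (n - i)] when [i] is even, so the signs multiply. *)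
Lemma tps_twistM F G : tps_even F ->
  tps_twist (F * G) = tps_twist F * tps_twist G.
Proof.
move=> F0; apply/funext => n; rewrite /tps_twist !tpsM mulr_sumr.
apply: eq_bigr => i _; case: (boolP (odd i)) => [/F0 ->|oi].
  by rewrite mul0r !mulr0 mul0r.
rewrite mulrACA -exprD; congr (_ ^+ _ * _).
by have := ltn_ord i; have := odd_double_half i; rewrite (negbTE oi); lia.
Qed.

End TpsTheory.

Lemma tps_unitE (R : comUnitRingType) (F : tps R) :
  (F \is a GRing.unit) = (F 0%N \is a GRing.unit).
Proof. by []. Qed.

(** * Exponential and circular series, with their differential equations *)

Definition exp_tps (a : rat) : tps rat := fun n => a ^+ n / n`!%:R.

Lemma fact_neq0 n : n`!%:R != 0 :> rat.
Proof. by rewrite pnatr_eq0 -lt0n fact_gt0. Qed.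

Lemma exp_tpsD a b : exp_tps (a + b) = exp_tps a * exp_tps b.
Proof.
apply/funext => n; rewrite tpsM /exp_tps addrC exprDn mulr_suml.
apply: eq_bigr => i _.
have le_in : (i <= n)%N by rewrite -ltnS.
rewrite -(bin_fact le_in) !natrM -mulr_natr.
have bn0 : 'C(n, i)%:R != 0 :> rat by rewrite pnatr_eq0 -lt0n bin_gt0.
by field; rewrite bn0 !fact_neq0.
Qed.

Lemma exp_tps0 : exp_tps 0 = 1.
Proof.
by apply/funext => -[|n]; rewrite /exp_tps tps1 ?expr0 ?divr1 //
  expr0n mul0r.
Qed.

Lemma cos_tps_unit : cos_tps \is a GRing.unit.
Proof. by rewrite tps_unitE /cos_tps expr0 divr1 unitr1. Qed.

Lemma cos_tps_inj (F G : tps rat) : cos_tps * F = cos_tps * G -> F = G.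
Proof. exact: (mulrI cos_tps_unit). Qed.

Lemma cos_sec : cos_tps * sec_tps = 1.
Proof. exact: mulrV cos_tps_unit. Qed.

Lemma cos_tan : cos_tps * tan_tps = sin_tps.
Proof. by rewrite mulrC divrK ?cos_tps_unit. Qed.

Lemma euler_cos : tps_euler cos_tps = - (tps_X rat * sin_tps).
Proof.
apply/funext => -[|n]; rewrite tpsN /tps_euler ?tps_XM0 ?oppr0 //.
rewrite tps_XMS /cos_tps /sin_tps /= -[LHS]mulr_natr.
case: (boolP (odd n)) => on /=; last by rewrite mul0r oppr0.
rewrite uphalf_half on /= exprS factS natrM.
by field; rewrite fact_neq0 /= ?nat1r ?natr1 pnatr_eq0.
Qed.

Lemma euler_sin : tps_euler sin_tps = tps_X rat * cos_tps.
Proof.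
apply/funext => -[|n]; rewrite /tps_euler ?tps_XM0 //.
rewrite tps_XMS /cos_tps /sin_tps /= -[LHS]mulr_natr.
case: (boolP (odd n)) => on /=; first by rewrite mul0r.
rewrite uphalf_half (negbTE on) /= factS natrM.
by field; rewrite fact_neq0 /= ?nat1r ?natr1 pnatr_eq0.
Qed.

Lemma euler_sec : tps_euler sec_tps = tps_X rat * tan_tps * sec_tps.
Proof.
apply: cos_tps_inj; have := congr1 (@tps_euler rat) cos_sec.
rewrite tps_eulerM tps_euler1 euler_cos => /eqP.
rewrite addrC addr_eq0 => /eqP ->; rewrite -cos_tan; ring.
Qed.

Lemma euler_tan : tps_euler tan_tps = tps_X rat * (1 + tan_tps * tan_tps).
Proof.
apply: cos_tps_inj; have := congr1 (@tps_euler rat) cos_tan.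
rewrite tps_eulerM euler_cos euler_sin => /eqP.
by rewrite addrC eq_sym -subr_eq => /eqP <-; rewrite -cos_tan; ring.
Qed.

(** By [tan' = 1 + tan^2], a positive multiple of each coefficient is a sum of products of earlier
    ones, plus 1 in degree 1. *)
Lemma tan_ge0 n : 0 <= tan_tps n.
Proof.
elim/ltn_ind: n => -[|n] IHn.
  have := congr1 (fun F : tps rat => F 0%N) cos_tan.
  by rewrite tpsM big_ord1 /cos_tps /sin_tps /= divr1 mul1r => ->.
have := congr1 (fun F : tps rat => F n.+1) euler_tan.
rewrite tps_XMS tpsD tps1 tpsM /tps_euler => e.
rewrite -(pmulrn_lge0 _ (ltn0Sn n)) e addr_ge0 ?ler0n //.
apply: sumr_ge0 => i _; rewrite mulr_ge0 ?IHn //.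
by rewrite ltnS leq_subr.
Qed.

Lemma dilateN1_cos : tps_dilate (-1) cos_tps = cos_tps.
Proof.
apply/funext => n; rewrite /tps_dilate /cos_tps -(signr_odd _ n).
by case: (odd n); rewrite ?mulr0 // expr0 mul1r.
Qed.

Lemma dilateN1_sin : tps_dilate (-1) sin_tps = - sin_tps.
Proof.
apply/funext => n; rewrite tpsN /tps_dilate /sin_tps -(signr_odd _ n).
by case: (odd n); rewrite ?expr1 ?mulN1r ?mulr0 ?oppr0.
Qed.

(** Changing [t] to [-t] fixes cosine and negates sine, hence negates the tangent. *)
Lemma tan_odd n : ~~ odd n -> tan_tps n = 0.
Proof.
have e : tps_dilate (-1) tan_tps = - tan_tps.
  apply: cos_tps_inj; rewrite -[in LHS]dilateN1_cos -tps_dilateM cos_tan.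
  by rewrite dilateN1_sin mulrN cos_tan.
move=> on; have := congr1 (fun F : tps rat => F n) e.
by rewrite tpsN /tps_dilate -(signr_odd _ n) (negbTE on) expr0; lra.
Qed.

Lemma X_tan_even : tps_even (tps_X rat * tan_tps).
Proof. by case=> [|n] //= on; rewrite tps_XMS tan_odd. Qed.

(** * Hyperbolic tangent and Bernoulli numbers *)

Lemma twist_cos : tps_twist cos_tps *+ 2 = exp_tps 1 + exp_tps (-1).
Proof.
apply/funext => n; rewrite mulr2n !tpsD /tps_twist /cos_tps /exp_tps.
rewrite -[in (-1) ^+ n](signr_odd _ n) expr1n.
case: (odd n) => /=; first by rewrite mulr0; ring.
by rewrite mulrA -exprD addnn -signr_odd odd_double.
Qed.

Lemma twist_sin : tps_twist sin_tps *+ 2 = exp_tps 1 - exp_tps (-1).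
Proof.
apply/funext => n; rewrite mulr2n !tpsD tpsN /tps_twist /sin_tps /exp_tps.
rewrite -[in (-1) ^+ n](signr_odd _ n) expr1n.
case: (odd n) => /=; last by rewrite mulr0; ring.
by rewrite mulrA -exprD addnn -signr_odd odd_double; ring.
Qed.

(* [tps_twist tan] is [tanh]. *)
Lemma tanh_exp :
  (exp_tps 2 + 1) * tps_twist tan_tps = exp_tps 2 - 1.
Proof.
have cos_even : tps_even cos_tps by move=> n on; rewrite /cos_tps on.
have e1 : exp_tps 1 * exp_tps (-1) = 1 by rewrite -exp_tpsD subrr exp_tps0.
have e2 : exp_tps 2 = exp_tps 1 * exp_tps 1 by rewrite -exp_tpsD.
have := tps_twistM tan_tps cos_even; rewrite cos_tan.
move=> /(congr1 (fun F => F *+ 2)).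
rewrite -mulrnAl twist_sin twist_cos e2 => h.
(* Multiplying [e^t + e^(-t)] and [e^t - e^(-t)] by [e^t] leaves only [e^(2t)]. *)
by rewrite -[in RHS]e1 -mulrBr h mulrA mulrDr e1.
Qed.

(** Isolates the factor [t], so that [kt/(e^(kt) - 1)] becomes the dilated inverse of the unit
    [expm1_div_t]. *)
Lemma expm1E k :
  exp_tps k%:R - 1 = tps_X rat * (tps_dilate k%:R expm1_div_t *+ k).
Proof.
apply/funext => -[|n]; rewrite tpsD tpsN tps1 ?tps_XM0 ?tps_XMS.
  by rewrite /exp_tps expr0 divr1 subrr.
by rewrite subr0 tpsMn /exp_tps /tps_dilate /expm1_div_t exprS
  -[RHS]mulr_natl mulrA.
Qed.

Lemma expm1_div_t_unit : expm1_div_t \is a GRing.unit.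
Proof. by rewrite tps_unitE /expm1_div_t invr1 unitr1. Qed.

(* In closed form: [t tanh t = t - 2t/(e^(2t) - 1) + 4t/(e^(4t) - 1)]. *)
Lemma X_tanh : tps_X rat * tps_twist tan_tps =
  tps_X rat - tps_dilate 2 expm1_div_t^-1 + tps_dilate 4 expm1_div_t^-1.
Proof.
set b2 := tps_dilate 2 _; set b4 := tps_dilate 4 _.
set e2 := exp_tps 2; set X := tps_X rat.
pose E2 := tps_dilate 2 expm1_div_t; pose E4 := tps_dilate 4 expm1_div_t.
have dE a : tps_dilate a expm1_div_t * tps_dilate a expm1_div_t^-1 = 1.
  by rewrite -tps_dilateM mulrV ?expm1_div_t_unit // tps_dilate1.
have Eb2 : E2 * b2 = 1 by exact: dE.
have Eb4 : E4 * b4 = 1 by exact: dE.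
have X2 : e2 - 1 = X * (E2 *+ 2) by exact: expm1E.
have E42 : E4 *+ 4 = E2 *+ 2 * (e2 + 1).
  apply: (@tps_X_lreg rat); rewrite mulrA -X2 -(expm1E 4).
  have -> : exp_tps 4 = e2 * e2 by rewrite -exp_tpsD.
  ring.
(* Since [b2 = 2t/(e^(2t) - 1)] and [b4 = 4t/(e^(4t) - 1)], this is
   [e^(4t) - 1 = (e^(2t) - 1)(e^(2t) + 1)]. *)
have b42 : b2 *+ 4 = b4 *+ 2 * (e2 + 1).
  transitivity (E4 *+ 4 * (b2 * b4)); first by rewrite -[LHS]mulr1 -Eb4; ring.
  by rewrite E42 -[RHS]mulr1 -{3}Eb2; ring.
have u2 : e2 + 1 \is a GRing.unit.
  by rewrite tps_unitE tpsD /e2 /exp_tps expr0 divr1 tps1.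
have two_lreg F G : F *+ 2 = G *+ 2 :> tps rat -> F = G.
  move=> e; apply/funext => n; have := congr1 (fun F : tps rat => F n) e.
  by rewrite !tpsMn; lra.
(* Clearing [e2 + 1] and doubling makes the [b4] term the right side of [b42], which leaves only
   [b2]. *)
apply: (mulrI u2); rewrite mulrCA tanh_exp -/e2; apply: two_lreg.
transitivity (X * (e2 + 1) *+ 2 - b2 *+ 2 * (e2 + 1) + b4 *+ 2 * (e2 + 1));
  last by ring.
rewrite -b42.
transitivity (X * (e2 + 1) *+ 2 - b2 *+ 2 * (e2 - 1)); last by ring.
have -> : b2 *+ 2 * (e2 - 1) = X *+ 4.
  by rewrite X2 -[RHS]mulr1 -Eb2; ring.
by ring.
Qed.

(** The factor of [phi] for a part [k]; its absolute value is the coefficient of [t^k] in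
    [log sec(sqrt t)]. *)
Definition log_coef k : rat :=
  (4 ^+ k * (4 ^+ k - 1) * bernoulli (2 * k)) / ((2 * k)%:R * (2 * k)`!%:R).

(** Compares coefficients of [t^(2k)] in [X_tanh]; the two dilations give
    [4^(2k) - 2^(2k) = 4^k (4^k - 1)]. *)
Lemma tan_bernoulli k : (0 < k)%N ->
  (2 * k)%:R * log_coef k = (-1) ^+ k.-1 * tan_tps (2 * k).-1.
Proof.
case: k => // k _; have := congr1 (fun F : tps rat => F (2 * k.+1)%N) X_tanh.
rewrite mulnS tps_XMS !tpsD tpsN /tps_twist /tps_dilate /=.
rewrite mul2n uphalf_double -mul2n => ->.
have -> : tps_X rat (2 + 2 * k)%N = 0 by [].
rewrite /log_coef /bernoulli -mulnS.
have k0 : (2 * k.+1)%:R != 0 :> rat by rewrite pnatr_eq0.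
have -> : 4 ^+ (2 * k.+1) = 4 ^+ k.+1 * 4 ^+ k.+1 :> rat.
  by rewrite -exprD addnn mul2n.
have -> : 2 ^+ (2 * k.+1) = 4 ^+ k.+1 :> rat.
  by rewrite exprM -natrX.
move: (2 * k.+1)%:R k0 (2 * k.+1)`!%:R (fact_neq0 (2 * k.+1)) => d d0 f f0.
by field; rewrite d0 f0.
Qed.

Lemma norm_log_coef k : (0 < k)%N ->
  `|log_coef k| *+ k *+ 2 = tan_tps (2 * k).-1.
Proof.
move=> k0; rewrite -mulrnA mulnC -mulr_natl -[(2 * k)%:R]ger0_norm ?ler0n //.
rewrite -normrM tan_bernoulli // normrM normrX normrN1 expr1n mul1r.
exact/ger0_norm/tan_ge0.
Qed.

(** * The logarithmic derivative of [sec(sqrt t)] *)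

Definition sec_log : tps rat := fun k => `|log_coef k| *+ k.

Lemma sec_sqrtE : sec_sqrt = tps_evenpart sec_tps.
Proof.
apply/funext => n; rewrite /sec_sqrt /euler tpsD tan_odd ?addr0 ?oddM //.
by rewrite mulrAC mulfV ?mul1r ?fact_neq0.
Qed.

(** The even part of [t sec' = (t tan) sec]. Degree [2n] becomes degree [n], so both sides carry a
    factor 2, which cancels. *)
Lemma euler_sec_sqrt : tps_euler sec_sqrt = sec_log * sec_sqrt.
Proof.
apply/funext => n; have := congr1 (fun F => tps_evenpart F n) euler_sec.
rewrite tps_evenpartM; last exact: X_tan_even.
rewrite sec_sqrtE.
have -> : tps_evenpart (tps_X rat * tan_tps) = sec_log *+ 2.
  apply/funext => -[|k]; rewrite /tps_evenpart tpsMn /sec_log.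
    by rewrite muln0 tps_XM0 mulr0n mul0rn.
  by rewrite norm_log_coef // mulnS tps_XMS.
rewrite mulrnAl tpsMn /tps_evenpart /tps_euler mulnC mulrnA; lra.
Qed.

Lemma sec_sqrt0 : sec_sqrt 0%N = 1.
Proof.
have := congr1 (fun F : tps rat => F 0%N) cos_sec.
by rewrite sec_sqrtE tpsM big_ord1 /cos_tps /= divr1 mul1r.
Qed.

(** * Monomials and power sums in infinitely many variables *)

Lemma expcmnS (u : {cmonom nat}) n : expcmn u n.+1 = mulcm u (expcmn u n).
Proof. by case: n => [|n] //; rewrite /= mulcm0. Qed.

Lemma expcmnE (u : {cmonom nat}) n i : expcmn u n i = (n * u i)%N.
Proof.
elim: n => [|n IHn]; first by rewrite onecmE.
by rewrite expcmnS mulcmE IHn.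
Qed.

Lemma mulcmK (u v : {cmonom nat}) : divcm (mulcm u v) u = v.
Proof. by apply/eqP/cmP => i; rewrite divcmE mulcmE addKn. Qed.

Definition cm_below N (m : {cmonom nat}) := forall i, (N <= i)%N -> m i = 0%N.

Lemma cm_below_divisor N m d : cm_below N m -> d \in cmdivisors m ->
  cm_below N d /\ cm_below N (divcm m d).
Proof.
rewrite mem_cmdivisors => mN /eqP dm; split=> i /mN.
  by rewrite -dm mulcmE; lia.
by rewrite divcmE => ->.
Qed.

Section XpsTheory.
Variable R : comNzRingType.

Lemma xpsM (F G : xps R) m :
  (F * G) m = \sum_(d <- cmdivisors m) F d * G (divcm m d).
Proof. by []. Qed.

Lemma xpsZ (a : R) (F : xps R) m : (a *: F) m = a * F m.
Proof. by []. Qed.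

Lemma xps_sum I (r : seq I) (P : pred I) (F : I -> xps R) m :
  (\sum_(i <- r | P i) F i) m = \sum_(i <- r | P i) F i m.
Proof. by elim/big_rec2: _ => // i x y _ <-. Qed.

Lemma xpsMn (F : xps R) k m : (F *+ k) m = F m *+ k.
Proof. by elim: k => // k IHk; rewrite !mulrS -IHk. Qed.

Definition xmonom (u : {cmonom nat}) : xps R := fun m => (m == u)%:R.

Lemma xmonomM u v : xmonom u * xmonom v = xmonom (mulcm u v).
Proof.
apply/funext => m; rewrite xpsM [RHS]/xmonom; case: eqP => [->|muv].
  rewrite (bigD1_seq u) ?cmdivisors_uniq ?mem_cmdivisors ?mulcmK //=.
  rewrite /xmonom !eqxx mulr1 big1 ?addr0 // => d /negbTE ->.
  by rewrite mul0r.
rewrite big_seq big1 // => d; rewrite mem_cmdivisors => /eqP dm.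
rewrite /xmonom; case: eqP => [du|]; last by rewrite mul0r.
case: eqP => [dv|]; last by rewrite mulr0.
by case: muv; rewrite -dm dv du.
Qed.

Lemma xvarX i n : xvar R i ^+ n = xmonom (expcmn (ucm i) n).
Proof.
by elim: n => // n IHn; rewrite exprS IHn expcmnS -xmonomM.
Qed.

(** The omitted variables do not occur in [m], and for [n > 0] the powers [x_i^n] are distinct, so
    at most one summand is nonzero at [m]. *)
Lemma psum_below N n m : (0 < n)%N -> cm_below N m ->
  (\sum_(i < N) xvar R i ^+ n) m = psum R n m.
Proof.
move=> n0 mN; rewrite xps_sum /psum.
under eq_bigr do rewrite xvarX /xmonom.
have pw (i j : nat) : m = expcmn (ucm i) n -> m j = (n * (i == j))%N.
  by move=> ->; rewrite expcmnE ucmE.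
case: asboolP => [[i mi]|nm]; last first.
  by rewrite big1 // => i _; case: eqP => // mi; case: nm; exists i.
have iN : (i < N)%N.
  rewrite ltnNge; apply/negP => /mN; rewrite (pw i) // eqxx; lia.
rewrite (bigD1 (Ordinal iN)) //= {1}mi eqxx big1 ?addr0 // => j ji.
case: eqP => // mj; move: (pw i i mi) (pw j i mj) ji.
by rewrite -val_eqE /= => ->; rewrite eqxx; case: eqP => // _; lia.
Qed.

Lemma seed_substM (f g : tps R) i :
  seed_subst (f * g) i = seed_subst f i * seed_subst g i.
Proof.
apply/funext => n; rewrite tpsM /seed_subst tpsM scaler_suml.
apply: eq_bigr => j _.
by rewrite -scalerAl -scalerAr scalerA -exprD subnKC // -ltnS.
Qed.

Lemma euler_seed_subst (f : tps R) i :
  tps_euler (seed_subst f i) = seed_subst (tps_euler f) i.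
Proof. by apply/funext => n; rewrite /tps_euler /seed_subst scalerMnl. Qed.

End XpsTheory.

(** * Infinite products characterised by a differential equation *)

Definition psum_series (R : comNzRingType) (h : tps R) : tps (xps R) :=
  fun n => h n *: psum R n.

(** No limit is involved: once [N] covers the variables of [m], the partial product agrees with [A]
    at [m] in every degree. *)
Lemma infprod_euler (f h : tps rat) (A : tps (xps rat)) :
    f 0%N = 1 -> h 0%N = 0 -> tps_euler f = h * f ->
    A 0%N = 1 -> tps_euler A = psum_series h * A ->
  is_infprod (seed_subst f) A.
Proof.
move=> f0 h0 ef A0 eA n m.
have [N0 mN0] : exists N0, cm_below N0 m.
  exists (\max_(i <- finsupp m) i).+1 => i; apply: contraTeq.
  rewrite -mem_finsupp -leqNgt => im.
  by rewrite (big_rem i im) leq_maxl.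
exists N0 => N le_N0N.
have {N0 mN0 le_N0N} mN : cm_below N m.
  by move=> i le_Ni; apply: mN0; apply: leq_trans le_Ni.
(* [U] is the sum of the [h(x_i t)], the truncation of [psum_series h] to [N] variables. *)
set P := \prod_(i < N) _; pose U := \sum_(i < N) seed_subst h i.
have eP : tps_euler P = U * P.
  apply: tps_euler_prod => i.
  by rewrite euler_seed_subst ef seed_substM.
have P0 : P 0%N = 1.
  rewrite /P; elim/big_rec: _ => // i F _ F0.
  by rewrite tpsM big_ord1 /seed_subst f0 scale1r mul1r F0.
(* The induction keeps [m] general because the recursion evaluates lower coefficients at divisors of
   [m]. *)
elim/ltn_ind: n m mN => -[|n] IHn m mN; first by rewrite P0 A0.
have Un : n.+1%:R != 0 :> rat by rewrite pnatr_eq0.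
have [e e'] : P n.+1 m *+ n.+1 = (U * P) n.+1 m /\
    A n.+1 m *+ n.+1 = (psum_series h * A) n.+1 m.
  by rewrite -eP -eA /tps_euler !xpsMn.
apply: (mulIf Un); rewrite !mulr_natr e e' !tpsM !xps_sum.
(* Index 0 is the only one involving the unknown coefficient of degree [n.+1]; it vanishes by
   [h0]. *)
apply: eq_bigr => -[[|i] lt_i] _ /=.
  by rewrite /U tps_sum /psum_series /seed_subst h0 big1 ?scale0r ?mul0r //
    => j _; rewrite scale0r.
rewrite !xpsM !big_seq; apply: eq_bigr => d /(cm_below_divisor mN)[dN mdN].
rewrite IHn //; last by rewrite subSS ltnS leq_subr.
by rewrite /U tps_sum /psum_series /seed_subst -scaler_sumr !xpsZ psum_below.
Qed.

(** * Partitions and the exponential of a power-sum series *)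

Definition part_weight (c : nat -> rat) (l : seq nat) : rat :=
  \prod_(1 <= k < (sumn l).+1) ((count_mem k l)`!%:R^-1 * c k ^+ count_mem k l).

Lemma leq_sumn (k : nat) l : k \in l -> (k <= sumn l)%N.
Proof.
elim: l => //= a l IHl; rewrite inE => /predU1P[->|/IHl]; first exact: leq_addr.
by move=> h; apply: leq_trans h (leq_addl _ _).
Qed.

Lemma part_weight_widen c l N : (sumn l <= N)%N ->
  part_weight c l =
  \prod_(1 <= k < N.+1) ((count_mem k l)`!%:R^-1 * c k ^+ count_mem k l).
Proof.
move=> lN; rewrite [RHS](@big_cat_nat _ _ _ (sumn l).+1) //=.
rewrite [X in _ * X]big_nat [X in _ * X]big1 ?mulr1 // => k /andP[lk _].
have -> : count_mem k l = 0%N.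
  by apply/count_memPn/negP => /leq_sumn; rewrite leqNgt lk.
by rewrite expr0 invr1 mulr1.
Qed.

(** Only the factor at [k] changes: [m c^m / m! = c c^(m-1) / (m-1)!], with [m] the multiplicity of
    [k] in [l']. *)
Lemma part_weight_cons c k l l' : (0 < k)%N -> perm_eq l' (k :: l) ->
  part_weight c l' *+ count_mem k l' = c k * part_weight c l.
Proof.
move=> k0 pl.
have cl j : count_mem j l' = ((k == j) + count_mem j l)%N by rewrite (permP pl).
have sl : sumn l' = (k + sumn l)%N by rewrite (perm_sumn pl).
rewrite (part_weight_widen c (l := l) (N := sumn l')) ?sl ?leq_addl //.
rewrite /part_weight sl.
have kin : k \in index_iota 1 (k + sumn l).+1.
  by rewrite mem_index_iota k0 ltnS leq_addr.
rewrite (bigD1_seq k) ?iota_uniq //= [in RHS](bigD1_seq k) ?iota_uniq //=.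
rewrite cl eqxx add1n -mulrnAl mulrA; congr (_ * _).
  rewrite exprS factS natrM -mulrnAl -[_ *+ _]mulr_natr.
  have f0 := fact_neq0 (count_mem k l).
  have s0 : (count_mem k l).+1%:R != 0 :> rat by rewrite pnatr_eq0.
  move: (_.+1)%:R s0 (_`!)%:R f0 => s s0 f f0.
  by field; rewrite s0 f0.
by apply: eq_bigr => j /negbTE jk; rewrite cl eq_sym jk.
Qed.

Lemma sumn_count_mem l N : (sumn l <= N)%N ->
  sumn l = (\sum_(k < N.+1) k * count_mem (k : nat) l)%N.
Proof.
elim: l => [|a l IHl] /= alN; first by rewrite big1 // => k _; rewrite muln0.
under eq_bigr do rewrite mulnDr.
rewrite big_split /= -IHl; last by apply: leq_trans alN; rewrite leq_addl.
have aN : (a < N.+1)%N by rewrite ltnS; apply: leq_trans alN; rewrite leq_addr.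
rewrite (bigD1 (Ordinal aN)) //= eqxx muln1 big1 ?addn0 // => k.
by rewrite -val_eqE /= eq_sym => /negbTE ->; rewrite muln0.
Qed.

Lemma is_partition_cons n k l : (0 < k)%N ->
  is_partition n l -> is_partition (k + n) (sort geq (k :: l)).
Proof.
move=> k0 /and3P[_ l0 /eqP ln]; apply/and3P; split.
- by apply: sort_sorted => x y; exact: leq_total.
- by rewrite mem_sort inE negb_or l0 eq_sym -lt0n k0.
- by rewrite (perm_sumn (permEl (perm_sort _ _))) /= ln.
Qed.

Lemma geq_sorted_eq l l' : sorted geq l -> sorted geq l' ->
  perm_eq l l' -> l = l'.
Proof.
apply: sorted_eq => [x y z|x y]; first by move=> h1 h2; exact: leq_trans h2 h1.
by rewrite andbC; exact: anti_leq.
Qed.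

(** Removing one copy of [k] is inverse to inserting [k] and sorting again. *)
Lemma perm_partitions_mem n k : (0 < k)%N -> (k <= n)%N ->
  perm_eq [seq l <- partitions n | k \in l]
          [seq sort geq (k :: l) | l <- partitions (n - k)].
Proof.
move=> k0 kn; apply: uniq_perm.
- exact/filter_uniq/partitions_uniq.
- rewrite map_inj_in_uniq ?partitions_uniq // => l l'.
  rewrite !mem_partitions => /and3P[sl _ _] /and3P[sl' _ _] e.
  apply: geq_sorted_eq => //; rewrite -(perm_cons k).
  by rewrite -(permPl (permEl (perm_sort geq _))) e perm_sort.
move=> l; rewrite mem_filter mem_partitions.
apply/andP/mapP => [[kl /and3P[sl l0 /eqP ln]]|[l' + ->]]; last first.
  rewrite mem_partitions => /(is_partition_cons k0); rewrite subnKC // => ->.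
  by rewrite mem_sort mem_head.
have pl := perm_to_rem kl; exists (rem k l).
  rewrite mem_partitions; apply/and3P; split.
  - apply: subseq_sorted sl; last exact: rem_subseq.
    by move=> x y z h1 h2; exact: leq_trans h2 h1.
  - by apply: contra l0; exact: mem_rem.
  - by rewrite -ln (perm_sumn pl) /= addKn.
apply: geq_sorted_eq => //.
  by apply: sort_sorted => x y; exact: leq_total.
by rewrite (permPl pl) perm_sym perm_sort.
Qed.

(** The expansion of [exp(sum_(k >= 1) c_k p_k t^k)]. *)
Definition part_series (c : nat -> rat) : tps (xps rat) :=
  fun n => \sum_(l <- partitions n) part_weight c l *: psum_part rat l.

Lemma part_series0 c : part_series c 0%N = 1.
Proof.
have p0 : perm_eq (partitions 0) [:: [::]].
  apply: uniq_perm => //; first exact: partitions_uniq.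
  case=> [|a l]; rewrite mem_partitions inE //=.
  by apply/negP => /and3P[_]; case: a.
rewrite /part_series (perm_big _ p0) big_seq1 /part_weight big_geq // scale1r.
by rewrite /psum_part big_nil.
Qed.

(** Writing [n] as the sum of [k m_k] over part sizes and exchanging sums, the terms for [k] come
    from partitions containing [k]; removing one [k] turns [m_k] times the weight into [c_k] times
    the smaller weight. *)
Lemma euler_part_series c :
  tps_euler (part_series c) = psum_series (tps_euler c) * part_series c.
Proof.
apply/funext => n; rewrite tpsM /tps_euler {1}/part_series -sumrMnl big_seq.
under eq_bigr => l.
  rewrite mem_partitions => /and3P[_ _ /eqP ln].
  rewrite -[X in _ *+ X]ln (@sumn_count_mem l n) ?ln // -sumrMnr.
  over.
rewrite -big_seq exchange_big /=; apply: eq_bigr => -[[|k] lt_k] _ /=.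
  by rewrite /psum_series /tps_euler mulr0n scale0r mul0r big1 //
    => l _; rewrite mul0n.
(* Partitions without the part [k.+1] have multiplicity 0 there and drop out. *)
rewrite (bigID (fun l => k.+1 \in l)) /= [X in _ + X]big1 ?addr0; last first.
  by move=> l /count_memPn ->; rewrite muln0.
rewrite -big_filter (perm_big _ (perm_partitions_mem _ _)) // big_map.
rewrite /part_series mulr_sumr; apply: eq_bigr => l _.
have pl : perm_eq (sort geq (k.+1 :: l)) (k.+1 :: l) by rewrite perm_sort.
rewrite /psum_part (perm_big _ pl) big_cons mulnC mulrnA !scalerMnl.
rewrite (part_weight_cons c _ pl) // -scalerAl -scalerAr scalerA.
by rewrite mulrnAl.
Qed.

Lemma norm_phi l :
  `|phi l| = (2 * sumn l)`!%:R * part_weight (fun k => `|log_coef k|) l.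
Proof.
rewrite /phi normrM ger0_norm ?ler0n //; congr (_ * _).
rewrite normr_prod; apply: eq_bigr => k _.
by rewrite normrM normrX ger0_norm ?invr_ge0 ?ler0n.
Qed.

Theorem theorem4p1 :
  sprout_sequence
    (fun n : nat =>
       ((2 * n)`!%:R)^-1 *:
       \sum_(l <- partitions n) `|phi l| *: psum_part rat l)
    sec_sqrt.
Proof.
split; first exact: sec_sqrt0.
set A := (fun n => _).
have -> : A = part_series (fun k => `|log_coef k|).
  apply/funext => n; rewrite /A scaler_sumr big_seq [RHS]big_seq.
  apply: eq_bigr => l; rewrite mem_partitions => /and3P[_ _ /eqP ln].
  by rewrite norm_phi ln scalerA mulKf // fact_neq0.
apply: (@infprod_euler _ sec_log).
- exact: sec_sqrt0.
- by rewrite /sec_log mulr0n.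
- exact: euler_sec_sqrt.
- exact: part_series0.
- exact: euler_part_series.
Qed.
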